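(* Let $a,b,c\in\mathbb C$ with $c\notin\mathbb Z$. Then, as power series in $t$ (with $\frac1{1-t}$ expanded in non-negative powers of $t$), $$F(a,b,c;t)F(-a,-b-2,-c;t)+\frac{3ab}{c(c-3)}\,t\,F(a+1,b+1,c+1;t)F(-a,-b-2,-c;t)$$ $$+\frac{3(a)_2(b)_2}{(c)_2(c-3)_2}\,t^2\,F(a+2,b+2,c+2;t)F(-a,-b-2,-c;t)$$ $$+\frac{(a)_3(b)_3}{(c-3)_6}\,t^3\,F(a+3,b+3,c+3;t)F(-a,-b-2,-c;t)$$ $$+\frac{a\,(b)_3\,(a-c)_4\,(c-b-3)_2}{(c-4)_5\,(c-3)_5}\,t^5\,F(a-c+4,b-c+4,5-c;t)F(-a+c+1,-b+c-1,c+2;t)$$ $$=1+\frac{a(3b-2c+6)}{c(c-3)}\,t+\frac{a(a-b-1)(c-b-3)_2}{(c-3)_4}\,t^2+\frac{a(b)_3}{(c-3)_4}\,\frac{t^2}{1-t}.$$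
   Context: $F(a,b,c;t)={}_2F_1(a,b,c;t)=\sum_{n\ge0}\frac{(a)_n(b)_n}{n!\,(c)_n}t^n$ is the Gauss hypergeometric series, with $(a)_n=a(a+1)\cdots(a+n-1)$. *)

(* Defs.v *)
From HB Require Import structures.
From mathcomp Require Import all_boot all_order all_algebra.
From mathcomp Require Import boolp reals.
From mathcomp Require Export complex.

Set Implicit Arguments.
Unset Strict Implicit.
Unset Printing Implicit Defensive.

Import GRing.Theory.
Local Open Scope ring_scope.

(* Formal power series in one variable t: the commutative K-algebra K[[t]],
   multiplication being the Cauchy product. *)
Record fps (K : Type) := FPS { fps_coef : nat -> K }.

HB.instance Definition _ (K : Type) := gen_eqMixin (fps K).
HB.instance Definition _ (K : Type) := gen_choiceMixin (fps K).

Lemma fpsP (K : Type) (f g : fps K) :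
  (forall n, fps_coef f n = fps_coef g n) <-> f = g.
Proof.
split=> [|->//]; case: f g => [f] [g] /= fg.
by congr FPS; apply/funext.
Qed.

Section FpsZmod.
Variable K : zmodType.
Implicit Types f g h : fps K.

Definition fps_zero : fps K := FPS (fun=> 0).
Definition fps_opp f : fps K := FPS (fun n => - fps_coef f n).
Definition fps_add f g : fps K := FPS (fun n => fps_coef f n + fps_coef g n).

Fact fps_addA : associative fps_add.
Proof. by move=> f g h; apply/fpsP => n; apply: addrA. Qed.
Fact fps_addC : commutative fps_add.
Proof. by move=> f g; apply/fpsP => n; apply: addrC. Qed.
Fact fps_add0 : left_id fps_zero fps_add.
Proof. by move=> f; apply/fpsP => n; apply: add0r. Qed.
Fact fps_addN : left_inverse fps_zero fps_opp fps_add.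
Proof. by move=> f; apply/fpsP => n; apply: addNr. Qed.

HB.instance Definition _ :=
  GRing.isZmodule.Build (fps K) fps_addA fps_addC fps_add0 fps_addN.

End FpsZmod.

Section FpsRing.
Variable K : comNzRingType.
Implicit Types f g h : fps K.

Definition fps_one : fps K := FPS (fun n => (n == 0%N)%:R).
Definition fps_mul f g : fps K :=
  FPS (fun n => \sum_(i < n.+1) fps_coef f i * fps_coef g (n - i)%N).
Definition fps_scale (x : K) f : fps K := FPS (fun n => x * fps_coef f n).

Definition fps_trunc m f : {poly K} := \poly_(i < m.+1) fps_coef f i.

Lemma coef_fps_trunc m f n : (n <= m)%N -> (fps_trunc m f)`_n = fps_coef f n.
Proof. by move=> le_nm; rewrite coef_poly ltnS le_nm. Qed.

Lemma coef_fps_mul_trunc m f g n : (n <= m)%N ->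
  fps_coef (fps_mul f g) n = (fps_trunc m f * fps_trunc m g)`_n.
Proof.
move=> le_nm; rewrite coefM; apply: eq_bigr => i _.
have le_in : (i <= n)%N by rewrite -ltnS.
rewrite !coef_fps_trunc //; first exact: leq_trans (leq_subr _ _) le_nm.
exact: leq_trans le_nm.
Qed.

Fact fps_mulA : associative fps_mul.
Proof.
move=> f g h; apply/fpsP => n.
transitivity ((fps_trunc n f * (fps_trunc n g * fps_trunc n h))`_n).
  rewrite coefM; apply: eq_bigr => i _.
  have le_in : (i <= n)%N by rewrite -ltnS.
  by rewrite coef_fps_trunc // (@coef_fps_mul_trunc n) ?leq_subr.
rewrite mulrA coefM; apply: eq_bigr => i _.
have le_in : (i <= n)%N by rewrite -ltnS.
by rewrite coef_fps_trunc ?leq_subr // (@coef_fps_mul_trunc n).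
Qed.

Fact fps_mulC : commutative fps_mul.
Proof.
by move=> f g; apply/fpsP => n; rewrite !(@coef_fps_mul_trunc n) // mulrC.
Qed.

Fact fps_mul1 : left_id fps_one fps_mul.
Proof.
move=> f; apply/fpsP => n /=; rewrite big_ord_recl /= mul1r subn0.
by rewrite big1 ?addr0 // => i _; rewrite mul0r.
Qed.

Fact fps_mulDl : left_distributive fps_mul (@fps_add K).
Proof.
move=> f g h; apply/fpsP => n /=; rewrite -big_split /=.
by apply: eq_bigr => i _; rewrite mulrDl.
Qed.

Fact fps_one_neq0 : fps_one != 0.
Proof. by apply/eqP => /fpsP/(_ 0%N)/eqP; rewrite oner_eq0. Qed.

HB.instance Definition _ := GRing.Zmodule_isComNzRing.Build (fps K)
  fps_mulA fps_mulC fps_mul1 fps_mulDl fps_one_neq0.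

Fact fps_scaleA x y f : fps_scale x (fps_scale y f) = fps_scale (x * y) f.
Proof. by apply/fpsP => n; apply: mulrA. Qed.
Fact fps_scale1 : left_id 1 fps_scale.
Proof. by move=> f; apply/fpsP => n; apply: mul1r. Qed.
Fact fps_scaleDr : right_distributive fps_scale +%R.
Proof. by move=> x f g; apply/fpsP => n; apply: mulrDr. Qed.
Fact fps_scaleDl f : {morph fps_scale^~ f : x y / x + y}.
Proof. by move=> x y; apply/fpsP => n; apply: mulrDl. Qed.

HB.instance Definition _ := GRing.Zmodule_isLmodule.Build K (fps K)
  fps_scaleA fps_scale1 fps_scaleDr fps_scaleDl.

Fact fps_scaleAl (x : K) f g : x *: (f * g) = x *: f * g.
Proof.
apply/fpsP => n /=; rewrite mulr_sumr.
by apply: eq_bigr => i _; rewrite mulrA.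
Qed.

HB.instance Definition _ :=
  GRing.Lmodule_isLalgebra.Build K (fps K) fps_scaleAl.
HB.instance Definition _ := GRing.Lalgebra_isComAlgebra.Build K (fps K).

Definition fpsX : fps K := FPS (fun n => (n == 1%N)%:R).

(* The expansion of 1 / (1 - t), see [fps_geomE]. *)
Definition fps_geom : fps K := FPS (fun=> 1).

Lemma fps_geomE : (1 - fpsX) * fps_geom = 1.
Proof.
apply/fpsP => -[|n] /=; first by rewrite big_ord1 !mulr1 subr0.
rewrite big_ord_recl big_ord_recl /= big1 ?addr0.
  by rewrite !mulr1 subr0 add0r subrr.
by move=> i _; rewrite subr0 mul0r.
Qed.

End FpsRing.

Arguments fpsX {K}.
Arguments fps_geom {K}.

(* Rising factorial (x)_n *)
Definition poch (K : comNzRingType) (x : K) (n : nat) : K :=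
  \prod_(i < n) (x + i%:R).

(* 2F1(a,b,c;t); as usual, c should not be a nonpositive integer. *)
Definition hyp2F1 (K : fieldType) (a b c : K) : fps K :=
  FPS (fun n => poch a n * poch b n / (n`!%:R * poch c n)).

(* Main.v *)
Require Import Defs.
From mathcomp Require Import all_boot all_order all_algebra.
From mathcomp Require Import reals.
From mathcomp Require Import ring zify.
Import GRing.Theory Num.Theory.
Local Open Scope ring_scope.

(** The four products sharing the factor F(-a,-b-2,-c) collapse: with
    theta = t d/dt, the bracket multiplying that factor is
    (theta + c-3)(theta + c-2)(theta + c-1) F(a,b,c) / (c-3)_3 = F(a,b,c-3),
    coefficientwise the Vandermonde sum for (c-3+n)_3 ([hyp2F1_lower3]).
    What remains to be proved is

      F(a,b,c-3) F(-a,-b-2,-c) + K t^5 F(a-c+4,b-c+4,5-c) F(c+1-a,c-1-b,c+2)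
        = rational function,

    a duality between the two local solutions at 0 of the hypergeometric
    equation and those of an equation contiguous to its adjoint
    ([hyp2F1_duality]).

    For n >= 4, write n = q + 4. The coefficient of t^n is a sum of residues.
    Combining each Pochhammer symbol of the first series with its partner in
    the second, (a)_k (-a)_(n-k) and so on, turns the k-th term of the first
    convolution into a (b)_3 / (c-3)_4 times the residue at s = k of

      R(s) = (s+a-q-3)_(q+3) (s+b-q-1)_(q+1)
             / (prod_(j <= n) (s-j) * prod_(l < q) (s - (q+3-c-l))),

    and the terms of the second convolution are the same multiple of the
    residues at the other poles s = q+3-c-i ([first_summandE],
    [second_summandE]). The numerator is monic, of degree one less than the
    denominator, so the residues of R add up to 1, whatever n is
    ([residue_sum], by Lagrange interpolation). Hence all coefficients from
    t^4 on equal a (b)_3 / (c-3)_4, which is the geometric tail of the right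
    hand side. For n < 4 the second product does not contribute and the
    identity between rational functions of a, b, c is checked directly
    ([low_coef]). *)

(** * Rising factorials *)

Section Pochhammer.
Variable K : comNzRingType.
Implicit Types x : K.

Lemma poch0 x : poch x 0 = 1.
Proof. exact: big_ord0. Qed.

Lemma pochS x n : poch x n.+1 = poch x n * (x + n%:R).
Proof. exact: big_ord_recr. Qed.

Lemma pochD x m n : poch x (m + n) = poch x m * poch (x + m%:R) n.
Proof.
elim: n => [|n IHn]; first by rewrite addn0 poch0 mulr1.
by rewrite addnS !pochS IHn natrD -mulrA addrA.
Qed.

Lemma poch_reflect x n : poch (1 - x - n%:R) n = (-1) ^+ n * poch x n.
Proof.
rewrite {2}/poch -[n in _ ^+ n]card_ord -prodrN.
rewrite /poch (reindex_inj rev_ord_inj); apply: eq_bigr => i _ /=.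
rewrite natrB ?ltn_ord // -natr1; ring.
Qed.

(** Up to sign the two factors are the products of x + j over the integer
    intervals [0, k) and [p - m, p). As p - m <= k, exchanging the right end
    points to get [0, p) and [p - m, k) does not change the multiset of all
    indices, and only the second interval still depends on k and m. *)
Lemma poch_overlap x k m p : (p <= k + m)%N ->
  poch x k * poch (1 - p%:R - x) m
  = (-1) ^+ m * (poch x p * poch (x + p%:R - m%:R) (k + m - p)).
Proof.
move=> le_p.
have -> : poch (1 - p%:R - x) m = (-1) ^+ m * poch (x + p%:R - m%:R) m.
  rewrite -poch_reflect; congr poch; ring.
rewrite mulrCA; congr (_ * _).
have [le_pk | /ltnW le_kp] := leqP p k.
  have -> : (k + m - p = m + (k - p))%N by lia.
  rewrite -{1}(subnKC le_pk) !pochD subrK; ring.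
have Em : (m = (k + m - p) + (p - k))%N by lia.
rewrite {2}Em -(subnKC le_kp) !pochD subnKC //.
have -> : x + p%:R - m%:R + (k + m - p)%:R = x + k%:R.
  rewrite natrB // natrD; ring.
ring.
Qed.

(** The companion of [poch_overlap] for intervals separated by a gap: here
    the gap has length p, and filling it produces a single interval. *)
Lemma poch_concat x k m p :
  poch (x - p%:R - m%:R) (m + p + k)
  = (-1) ^+ m * (poch x k * poch (1 + p%:R - x) m * poch (x - p%:R) p).
Proof.
rewrite !pochD natrD subrK.
have -> : x - p%:R - m%:R + (m%:R + p%:R) = x by ring.
have -> : x - p%:R - m%:R = 1 - (1 + p%:R - x) - m%:R by ring.
rewrite poch_reflect; ring.
Qed.

Lemma falling_poch x n : \prod_(j < n) (x - j%:R) = poch (x + 1 - n%:R) n.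
Proof.
rewrite /poch (reindex_inj rev_ord_inj); apply: eq_bigr => i _ /=.
rewrite natrB ?ltn_ord // -natr1; ring.
Qed.

(** The derivative at k of X (X - 1) ... (X - n), hence the denominator of
    a residue at an integer node. *)
Lemma prod_diff_fact k n : (k <= n)%N ->
  \prod_(j < n.+1 | j != k :> nat) (k%:R - j%:R)
  = (-1) ^+ (n - k) * (k`! * (n - k)`!)%:R :> K.
Proof.
elim: n => [|n IHn] le_kn.
  move: le_kn; rewrite leqn0 => /eqP->.
  by rewrite big_mkcond big_ord1 /= mulr1.
rewrite big_mkcond big_ord_recr -big_mkcond /=.
have [le | lt] := leqP k n.
  have -> /= : n.+1 != k by lia.
  rewrite IHn // subSn // exprS factS !natrM.
  rewrite -[(n - k).+1%:R]natr1 -[n.+1%:R]natr1 natrB //; ring.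
have -> : k = n.+1 by lia.
rewrite eqxx /= mulr1 subnn fact0 muln1 expr0 mul1r.
elim: n {IHn lt le_kn} => [|n IHn]; first by rewrite big_mkcond big_ord1 /= subr0.
rewrite big_mkcond big_ord_recl /= factS natrM -IHn subr0; congr (_ * _).
rewrite [RHS]big_mkcond; apply: eq_bigr => i _ /=.
rewrite /bump /= add1n eqSS; case: eqP => // _.
rewrite -[n.+2%:R]natr1 -[i.+1%:R]natr1; ring.
Qed.

End Pochhammer.

(** * Rising factorials as polynomials *)

Section PochPoly.
Variable K : comNzRingType.
Implicit Types x : K.

Lemma horner_poch (p : {poly K}) x n : (poch p n).[x] = poch p.[x] n.
Proof.
elim: n => [|n IHn]; first by rewrite !poch0 -polyC1 hornerC.
by rewrite !pochS hornerM hornerD IHn hornerMn -polyC1 hornerC.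
Qed.

Lemma poch_monic x n : poch ('X + x%:P) n \is monic.
Proof.
elim: n => [|n IHn]; first by rewrite poch0 monic1.
by rewrite pochS monicMl // -polyC_natr -addrA -polyCD monicXaddC.
Qed.

Lemma size_poch x n : size (poch ('X + x%:P) n) = n.+1.
Proof.
elim: n => [|n IHn]; first by rewrite poch0 size_polyC oner_neq0.
rewrite pochS -polyC_natr -addrA -polyCD.
rewrite size_monicM ?poch_monic ?size_XaddC ?IHn ?addn2 //.
by rewrite -size_poly_eq0 size_XaddC.
Qed.

End PochPoly.

(** * The sum of the residues *)

Section Residues.
Variable K : fieldType.

(** The sum of the residues of p / prod_j (X - x j): comparing the
    coefficients of degree n in Lagrange's interpolation formula shows that
    it is the opposite of the residue at infinity. *)
Lemma lagrange_top_coef (x : nat -> K) n (p : {poly K}) :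
  injective x -> (size p <= n.+1)%N ->
  \sum_(i < n.+1) p.[x i] / \prod_(j < n.+1 | j != i) (x i - x j) = p`_n.
Proof.
move=> x_inj sz_p.
rewrite [in RHS](@qpoly.lagrange_gen _ _ x _ x_inj p sz_p) // coef_sum.
apply: eq_bigr => i _; rewrite coefCM qpoly.lagrangeE //=.
set P := (X in (_%:P * X)`__).
have monP : P \is monic by exact: monic_prod_XsubC.
have szP : size P = n.+1.
  rewrite /P -big_filter size_prod_XsubC; congr _.+1.
  by rewrite size_filter -sum1_count sum1_card cardC1 card_ord.
have Pn : P`_n = 1.
  by move/monicP: monP; rewrite lead_coefE szP.
rewrite coefCM Pn mulr1 horner_prod; congr (_ / _).
by apply: eq_bigr => j _; rewrite hornerXsubC.
Qed.

End Residues.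

(** * Coefficients of power series *)

Section Coefficients.
Variable K : comNzRingType.
Implicit Types f g : fps K.

Lemma fps_coefD f g n : fps_coef (f + g) n = fps_coef f n + fps_coef g n.
Proof. by []. Qed.

Lemma fps_coefZ x f n : fps_coef (x *: f) n = x * fps_coef f n.
Proof. by []. Qed.

Lemma fps_coefM f g n :
  fps_coef (f * g) n = \sum_(i < n.+1) fps_coef f i * fps_coef g (n - i)%N.
Proof. by []. Qed.

Lemma fps_coefXM f n :
  fps_coef (fpsX * f) n = if n is n'.+1 then fps_coef f n' else 0.
Proof.
case: n => [|n]; rewrite fps_coefM; first by rewrite big_ord1 /= mul0r.
rewrite !big_ord_recl /= mul0r add0r mul1r subn1 big1 ?addr0 // => i _.
by rewrite mul0r.
Qed.

Lemma fps_coefXnM f j n :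
  fps_coef (fpsX ^+ j * f) n = if (j <= n)%N then fps_coef f (n - j)%N else 0.
Proof.
elim: j n => [|j IHj] n; first by rewrite mul1r subn0.
by rewrite exprS -mulrA fps_coefXM; case: n => [//|n]; rewrite IHj.
Qed.

Lemma natr_ffact n j : (n ^_ j)%:R = \prod_(i < j) (n%:R - i%:R) :> K.
Proof.
elim: j => [|j IHj]; first by rewrite big_ord0.
rewrite big_ord_recr -IHj ffactnSr natrM /=.
have [le_jn | lt_nj] := leqP j n; first by rewrite natrB.
by rewrite ffact_small // !mul0r.
Qed.

End Coefficients.

(** * The hypergeometric identity *)

Section Identity.
Variable K : numFieldType.
Variables a b c : K.
Hypothesis c_nint : forall m : int, c <> m%:~R.

Lemma subrnn_neq0 m n : c + m%:R - n%:R != 0.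
Proof.
apply/eqP => /eqP; rewrite -addrA addr_eq0 => /eqP E.
apply: (c_nint (n%:Z - m%:Z)); rewrite E rmorphB /= -!pmulrn; ring.
Qed.

Lemma poch_neq0 m n p : poch (c + m%:R - n%:R) p != 0.
Proof.
apply/prodf_neq0 => i _.
have -> : c + m%:R - n%:R + i%:R = c + (m + i)%:R - n%:R by rewrite natrD; ring.
exact: subrnn_neq0.
Qed.

Lemma pochN_neq0 n p : poch (n%:R - c) p != 0.
Proof.
apply/prodf_neq0 => j _; rewrite -oppr_eq0.
have -> : - (n%:R - c + j%:R) = c + 0%:R - (n + j)%:R by rewrite natrD; ring.
exact: subrnn_neq0.
Qed.

Lemma prod_diff_factN i q : (i < q)%N ->
  \prod_(j < q | j != i :> nat) (j%:R - i%:R)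
  = (-1) ^+ i * (i`! * (q.-1 - i)`!)%:R :> K.
Proof.
case: q => [//|q] lt_iq /=.
have := prod_diff_fact K i q lt_iq.
rewrite (eq_bigr (fun j : 'I_q.+1 => - (j%:R - i%:R))) => [|j _]; last by ring.
rewrite prodrN (_ : #|_| = q); last first.
  transitivity #|predC1 (Ordinal lt_iq)|; last by rewrite cardC1 card_ord.
  exact: eq_card.
move/(congr1 ( *%R ((-1) ^+ q))).
rewrite mulrA -exprMn mulrNN mulr1 expr1n mul1r => ->.
rewrite mulrA -exprD; congr (_ * _).
by rewrite -signr_odd -[RHS]signr_odd; congr (_ ^+ nat_of_bool _); lia.
Qed.

(** The nodes 0, ..., q + 4 followed by q + 3 - c - l for l < q; the second
    family is disjoint from the first because c is not an integer. *)
Let pole q (j : nat) : K :=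
  if (j < 5 + q)%N then j%:R else q%:R + 3 - c - (j - (5 + q))%:R.

Let pole_inj q : injective (pole q).
Proof.
have nat_inj (m n : nat) : m%:R = n%:R :> K -> m = n.
  by move/eqP; rewrite eqr_nat => /eqP.
move=> i j; rewrite /pole; case: ltnP => hi; case: ltnP => hj.
- exact: nat_inj.
- move=> E; case/eqP: (subrnn_neq0 (i + (j - (5 + q))) (3 + q)).
  rewrite !natrD E; ring.
- move=> E; case/eqP: (subrnn_neq0 (j + (i - (5 + q))) (3 + q)).
  rewrite !natrD -E; ring.
- by move/addrI/oppr_inj/nat_inj => E; lia.
Qed.

(** The first sum runs over the poles at integers, the second one over the
    poles at q + 3 - c - i, of the rational function whose numerator is the
    monic polynomial of degree 2q + 4 evaluated in each term; there are
    2q + 5 poles, so the total is the leading coefficient 1. *)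
Lemma residue_sum q :
  \sum_(k < 5 + q)
     poch (k%:R + a - (q%:R + 3)) (3 + q) * poch (k%:R + b - (q%:R + 1)) (1 + q)
     / ((-1) ^+ (4 + q - k) * (k`! * (4 + q - k)`!)%:R
        * poch (c + k%:R - (q%:R + 3)) q)
  + \sum_(i < q)
     poch (a - c - i%:R) (3 + q) * poch (b - c + 2 - i%:R) (1 + q)
     / (poch (- 1 - c - i%:R) (5 + q)
        * ((-1) ^+ i * (i`! * (q.-1 - i)`!)%:R)) = 1.
Proof.
pose N : {poly K} :=
  poch ('X + (a - (q%:R + 3))%:P) (3 + q)
  * poch ('X + (b - (q%:R + 1))%:P) (1 + q).
have N_monic : N \is monic by rewrite monicMl ?poch_monic.
have N_size : size N = (4 + q + q).+1.
  rewrite size_monicM ?monic_neq0 ?poch_monic // !size_poch; lia.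
have := @lagrange_top_coef K (pole q) (4 + q + q) N (@pole_inj q).
rewrite N_size => /(_ (leqnn _)).
have -> : N`_(4 + q + q) = 1 by move/monicP: N_monic; rewrite lead_coefE N_size.
have -> : (4 + q + q).+1 = (5 + q + q)%N by lia.
rewrite big_split_ord /= => E; rewrite -[RHS]E.
congr (_ + _); apply: eq_bigr => i _.
- have lt_i : (i < 5 + q)%N := ltn_ord i.
  rewrite /pole lt_i hornerM !horner_poch !hornerD !hornerX !hornerC.
  congr (_ * _ / _).
  + by congr poch; ring.
  + by congr poch; ring.
  rewrite [RHS](@big_split_ord _ _ _ (5 + q) q) /=; congr (_ * _).
    rewrite -prod_diff_fact; last by rewrite -ltnS.
    by apply: eq_big => j; rewrite ?eq_lshift //= (ltn_ord j : (j < 5 + q)%N).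
  rewrite /poch; apply: eq_big => [j|j _]; first by rewrite eq_rlshift.
  rewrite ltnNge leq_addr /= addKn; ring.
- rewrite /pole ltnNge leq_addr /= addKn.
  rewrite hornerM !horner_poch !hornerD !hornerX !hornerC.
  congr (_ * _ / _).
  + by congr poch; ring.
  + by congr poch; ring.
  rewrite [RHS](@big_split_ord _ _ _ (5 + q) q) /=; congr (_ * _).
    rewrite (eq_big xpredT
      (fun j : 'I_(5 + q) => q%:R + 3 - c - i%:R - j%:R)) => [||j _].
    - by rewrite falling_poch natrD; congr poch; ring.
    - by move=> j; rewrite eq_lrshift.
    by rewrite (ltn_ord j : (j < 5 + q)%N).
  rewrite -prod_diff_factN ?ltn_ord //.
  apply: eq_big => [j|j _]; first by rewrite eq_rshift.
  rewrite ltnNge leq_addr /= addKn; ring.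
Qed.

(** Each of the three pairs of Pochhammer symbols with parameters summing to
    0, -2 and -3 merges by [poch_overlap], with p = 1, 3 and 4; the
    factors (a)_1, (b)_3 and (c-3)_4 split off are the constant. The
    last pair is what requires k + m >= 4. *)
Lemma first_summandE k m q : (k + m = 4 + q)%N ->
  poch a k * poch b k / (k`!%:R * poch (c - 3) k)
  * (poch (- a) m * poch (- b - 2) m / (m`!%:R * poch (- c) m))
  = a * poch b 3 / poch (c - 3) 4
    * (poch (k%:R + a - (q%:R + 3)) (3 + q) * poch (k%:R + b - (q%:R + 1)) (1 + q)
       / ((-1) ^+ m * (k`! * m`!)%:R * poch (c + k%:R - (q%:R + 3)) q)).
Proof.
move=> km.
have Ek : k%:R = q%:R + 4 - m%:R :> K.
  by rewrite -(addrK m%:R k%:R) -(natrD _ k m) km natrD; ring.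
have Ha := @poch_overlap K a k m 1 ltac:(lia).
have Hb := @poch_overlap K b k m 3 ltac:(lia).
have Hc := @poch_overlap K (c - 3) k m 4 ltac:(lia).
have := poch_neq0 1 m q.
have := poch_neq0 0 3 4.
rewrite addr0; move: Ha Hb Hc; rewrite km.
have -> : 1 - 1 - a = - a by ring.
have -> : 1 - 3 - b = - b - 2 by ring.
have -> : 1 - 4 - (c - 3) = - c by ring.
have -> : (4 + q - 1 = 3 + q)%N by lia.
have -> : (4 + q - 3 = 1 + q)%N by lia.
have -> : (4 + q - 4 = q)%N by lia.
have -> : a + 1 - m%:R = k%:R + a - (q%:R + 3) by rewrite Ek; ring.
have -> : b + 3 - m%:R = k%:R + b - (q%:R + 1) by rewrite Ek; ring.
have -> : c - 3 + 4 - m%:R = c + k%:R - (q%:R + 3) by rewrite Ek; ring.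
have -> : c + 1 - m%:R = c + k%:R - (q%:R + 3) by rewrite Ek; ring.
have -> : poch a 1 = a by rewrite pochS poch0 mul1r addr0.
move=> Ha Hb Hc nz1 nz2.
have k0 : k`!%:R != 0 :> K by rewrite pnatr_eq0 -lt0n fact_gt0.
have m0 : m`!%:R != 0 :> K by rewrite pnatr_eq0 -lt0n fact_gt0.
transitivity (poch a k * poch (- a) m * (poch b k * poch (- b - 2) m)
  / (k`!%:R * m`!%:R * (poch (c - 3) k * poch (- c) m))).
  by rewrite !invfM; ring.
(* The three merged pairs leave three signs on one side and one on the other;
   splitting on the parity of m makes them numerals that field can cancel. *)
rewrite Ha Hb Hc natrM -signr_odd; case: (odd m); rewrite ?expr0 ?expr1; field;
  by rewrite ?nz1 ?nz2 ?k0 ?m0.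
Qed.

(** Here the pairs have parameters summing to 5, 3 and 7 and are separated by
    gaps of length 4, 2 and 6 ([poch_concat]); the missing factors are those
    of the constant in front of t^5. *)
Lemma second_summandE i k q : (i + k).+1 = q ->
  a * poch b 3 * poch (a - c) 4 * poch (c - b - 3) 2
       / (poch (c - 4) 5 * poch (c - 3) 5)
  * (poch (a - c + 4) k * poch (b - c + 4) k / (k`!%:R * poch (5 - c) k)
     * (poch (- a + c + 1) i * poch (- b + c - 1) i / (i`!%:R * poch (c + 2) i)))
  = a * poch b 3 / poch (c - 3) 4
    * (poch (a - c - i%:R) (3 + q) * poch (b - c + 2 - i%:R) (1 + q)
       / (poch (- 1 - c - i%:R) (5 + q) * ((-1) ^+ i * (i`! * k`!)%:R))).
Proof.
move=> <-.
have := @poch_concat K (a - c + 4) k i 4.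
have := @poch_concat K (b - c + 4) k i 2.
have := @poch_concat K (5 - c) k i 6.
have -> : (i + 4 + k = 3 + (i + k).+1)%N by lia.
have -> : (i + 2 + k = 1 + (i + k).+1)%N by lia.
have -> : (i + 6 + k = 5 + (i + k).+1)%N by lia.
have -> : a - c + 4 - 4 = a - c by ring.
have -> : b - c + 4 - 2 = b - c + 2 by ring.
have -> : 5 - c - 6 = - 1 - c by ring.
have -> : 1 + 4 - (a - c + 4) = - a + c + 1 by ring.
have -> : 1 + 2 - (b - c + 4) = - b + c - 1 by ring.
have -> : 1 + 6 - (5 - c) = c + 2 by ring.
move=> -> -> ->.
have -> : poch (b - c + 2) 2 = poch (c - b - 3) 2.
  by rewrite !pochS !poch0; ring.
have -> : poch (- 1 - c) 6 = poch (c - 4) 6.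
  by rewrite !pochS !poch0; ring.
have k0 : k`!%:R != 0 :> K by rewrite pnatr_eq0 -lt0n fact_gt0.
have i0 : i`!%:R != 0 :> K by rewrite pnatr_eq0 -lt0n fact_gt0.
have E : poch (c - 4) 5 * poch (c - 3) 5 = poch (c - 3) 4 * poch (c - 4) 6.
  by rewrite !pochS !poch0; ring.
have := poch_neq0 0 3 4; have := poch_neq0 0 4 6; have := poch_neq0 2 0 i.
rewrite subr0 addr0 E => nz1 nz2 nz3.
have nz4 := pochN_neq0 5 k.
rewrite natrM -signr_odd; case: (odd i); rewrite ?expr0 ?expr1; field;
  by rewrite ?nz1 ?nz2 ?nz3 ?nz4 ?k0 ?i0.
Qed.

(** Both sides are the coefficients of t^j times the j-th derivative of
    F(u,v,w). *)
Lemma ffact_hyp2F1 u v w j n :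
  poch u j * poch v j / poch w j
    * fps_coef (fpsX ^+ j * hyp2F1 (u + j%:R) (v + j%:R) (w + j%:R)) n
  = (n ^_ j)%:R * fps_coef (hyp2F1 u v w) n :> K.
Proof.
rewrite fps_coefXnM; case: leqP => [le_jn | lt_nj]; last first.
  by rewrite ffact_small // mulr0 mul0r.
have [m ->] : exists m, n = (j + m)%N by exists (n - j)%N; rewrite subnKC.
have nz : ((j + m) ^_ j)%:R != 0 :> K.
  by rewrite pnatr_eq0 -lt0n ffact_gt0 leq_addr.
rewrite /= -(ffact_fact (leq_addr m j)) addKn !pochD natrM !invfM.
rewrite -[LHS]mul1r -[X in X * _](divff nz); ring.
Qed.

(** Raising the lower parameter from c-3 to c is undone by the operator
    (theta + c-3)(theta + c-2)(theta + c-1) / (c-3)_3; written in powers of t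
    and d/dt, it has the coefficients binomial(3, j) / (c-3)_j. *)
Lemma hyp2F1_lower3 :
  hyp2F1 a b c
  + (3 * a * b / (c * (c - 3))) *: (fpsX * hyp2F1 (a + 1) (b + 1) (c + 1))
  + (3 * poch a 2 * poch b 2 / (poch c 2 * poch (c - 3) 2)) *:
      (fpsX ^+ 2 * hyp2F1 (a + 2) (b + 2) (c + 2))
  + (poch a 3 * poch b 3 / poch (c - 3) 6) *:
      (fpsX ^+ 3 * hyp2F1 (a + 3) (b + 3) (c + 3))
  = hyp2F1 a b (c - 3).
Proof.
apply/fpsP => n.
have D j := ffact_hyp2F1 a b c j n.
have poch1 (x : K) : poch x 1 = x by rewrite pochS poch0 mul1r addr0.
have E6 : poch (c - 3) 6 = poch (c - 3) 3 * poch c 3.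
  by rewrite (@pochD _ _ 3 3) subrK.
rewrite !fps_coefD !fps_coefZ.
transitivity (fps_coef (hyp2F1 a b c) n
  * (1 + 3 / (c - 3) * (n ^_ 1)%:R + 3 / poch (c - 3) 2 * (n ^_ 2)%:R
       + 1 / poch (c - 3) 3 * (n ^_ 3)%:R)).
  have := (D 1%N, D 2%N, D 3%N); rewrite !poch1 expr1 => -[[D1 D2] D3].
  have distr (F x1 x2 x3 y1 y2 y3 : K) :
    F * (1 + x1 * y1 + x2 * y2 + x3 * y3)
    = F + x1 * (y1 * F) + x2 * (y2 * F) + x3 * (y3 * F) by ring.
  rewrite distr -D1 -D2 -D3 E6 !invfM; ring.
rewrite !natr_ffact !big_ord_recr !big_ord0 /=.
have P : poch (c - 3) 3 * poch c n = poch (c - 3) n * poch (c - 3 + n%:R) 3.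
  by rewrite -pochD addnC pochD subrK.
have := poch_neq0 0 3 3; have := poch_neq0 0 0 n; have := poch_neq0 n 3 3.
have -> : c + n%:R - 3 = c - 3 + n%:R by ring.
rewrite !addr0 subr0 => nzT nzC nzB.
have I : (poch (c - 3) n)^-1 = poch (c - 3 + n%:R) 3 / (poch (c - 3) 3 * poch c n).
  by rewrite P invfM mulrCA divff // mulr1.
rewrite !invfM I -!mulrA; do 3 congr (_ * _).
move: nzB; rewrite !pochS !poch0 mul1r addr0 !mulf_eq0 !negb_or.
by move=> /andP[/andP[nz3 nz2] nz1]; field; rewrite nzC nz1 nz2 nz3.
Qed.

Lemma low_coef n : (n < 4)%N ->
  fps_coef (hyp2F1 a b (c - 3) * hyp2F1 (- a) (- b - 2) (- c)) n
  = fps_coef (1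
    + (a * (3 * b - 2 * c + 6) / (c * (c - 3))) *: fpsX
    + (a * (a - b - 1) * poch (c - b - 3) 2 / poch (c - 3) 4) *: fpsX ^+ 2
    + (a * poch b 3 / poch (c - 3) 4) *: (fpsX ^+ 2 * fps_geom)) n.
Proof.
have := poch_neq0 0 3 4; have := pochN_neq0 0 3.
rewrite !pochS !poch0 !mul1r !addr0 sub0r !mulf_eq0 !negb_or.
move=> /andP[/andP[nzN0 nzN1] nzN2] /andP[/andP[/andP[nz3 nz2] nz1] nz0].
rewrite !fps_coefD !fps_coefZ -[fpsX ^+ 2 in X in _ + X + _]mulr1 !fps_coefXnM.
have nzc : c != 0 by rewrite -oppr_eq0.
case: n => [|[|[|[|//]]]] _; rewrite fps_coefM !big_ord_recr big_ord0 /=;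
  rewrite ?subSS !subn0 ?factS fact0 ?pochS !poch0; field;
  by rewrite ?nzc ?nz0 ?nz1 ?nz2 ?nz3 ?nzN1 ?nzN2.
Qed.

Lemma high_coef q :
  fps_coef (hyp2F1 a b (c - 3) * hyp2F1 (- a) (- b - 2) (- c)) (4 + q)
  + a * poch b 3 * poch (a - c) 4 * poch (c - b - 3) 2
       / (poch (c - 4) 5 * poch (c - 3) 5)
    * fps_coef (fpsX ^+ 5 * (hyp2F1 (a - c + 4) (b - c + 4) (5 - c)
         * hyp2F1 (- a + c + 1) (- b + c - 1) (c + 2))) (4 + q)
  = a * poch b 3 / poch (c - 3) 4.
Proof.
rewrite -[RHS]mulr1 -[X in _ = _ * X](residue_sum q) mulrDr; congr (_ + _).
  rewrite fps_coefM mulr_sumr; apply: eq_bigr => k _.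
  by rewrite -first_summandE //; apply: subnKC; rewrite -ltnS.
case: q => [|q]; first by rewrite fps_coefXnM big_ord0 !mulr0.
rewrite -[in LHS](addSnnS 4 q) fps_coefXnM leq_addr addKn.
rewrite [hyp2F1 (a - c + 4) _ _ * _]mulrC fps_coefM !mulr_sumr.
apply: eq_bigr => i _; rewrite [fps_coef _ _ * _]mulrC.
by apply: second_summandE; rewrite subnKC // -ltnS.
Qed.

End Identity.

(** The identity in terms of F(a,b,c-3), where its symmetry is visible: the
    second product is built from the other local solutions
    t^(4-c) F(a-c+4,b-c+4,5-c) and t^(c+1) F(c+1-a,c-1-b,c+2) at 0. *)
Lemma hyp2F1_duality (K : numFieldType) (a b c : K)
    (hc : forall m : int, c <> m%:~R) :
  hyp2F1 a b (c - 3) * hyp2F1 (- a) (- b - 2) (- c)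
  + (a * poch b 3 * poch (a - c) 4 * poch (c - b - 3) 2
       / (poch (c - 4) 5 * poch (c - 3) 5)) *:
      (fpsX ^+ 5 * (hyp2F1 (a - c + 4) (b - c + 4) (5 - c)
         * hyp2F1 (- a + c + 1) (- b + c - 1) (c + 2)))
  = 1
    + (a * (3 * b - 2 * c + 6) / (c * (c - 3))) *: fpsX
    + (a * (a - b - 1) * poch (c - b - 3) 2 / poch (c - 3) 4) *: fpsX ^+ 2
    + (a * poch b 3 / poch (c - 3) 4) *: (fpsX ^+ 2 * fps_geom).
Proof.
apply/fpsP => n; rewrite fps_coefD fps_coefZ.
have [lt_n4 | le_4n] := ltnP n 4.
  by rewrite fps_coefXnM leqNgt ltnW // mulr0 addr0 low_coef.
rewrite -(subnKC le_4n) (high_coef _ a b c hc).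
rewrite !fps_coefD !fps_coefZ -[fpsX ^+ 2 in X in _ + X + _]mulr1 !fps_coefXnM /=.
by rewrite !mulr0 mulr1 !add0r.
Qed.

Lemma hyp2F1_expanded_duality (K : numFieldType) (a b c : K)
    (hc : forall m : int, c <> m%:~R) :
  hyp2F1 a b c * hyp2F1 (- a) (- b - 2) (- c)
  + (3 * a * b / (c * (c - 3))) *:
      (fpsX * hyp2F1 (a + 1) (b + 1) (c + 1) * hyp2F1 (- a) (- b - 2) (- c))
  + (3 * poch a 2 * poch b 2 / (poch c 2 * poch (c - 3) 2)) *:
      (fpsX ^+ 2 * hyp2F1 (a + 2) (b + 2) (c + 2)
         * hyp2F1 (- a) (- b - 2) (- c))
  + (poch a 3 * poch b 3 / poch (c - 3) 6) *:
      (fpsX ^+ 3 * hyp2F1 (a + 3) (b + 3) (c + 3)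
         * hyp2F1 (- a) (- b - 2) (- c))
  + (a * poch b 3 * poch (a - c) 4 * poch (c - b - 3) 2
       / (poch (c - 4) 5 * poch (c - 3) 5)) *:
      (fpsX ^+ 5 * hyp2F1 (a - c + 4) (b - c + 4) (5 - c)
         * hyp2F1 (- a + c + 1) (- b + c - 1) (c + 2))
  = 1
    + (a * (3 * b - 2 * c + 6) / (c * (c - 3))) *: fpsX
    + (a * (a - b - 1) * poch (c - b - 3) 2 / poch (c - 3) 4) *: fpsX ^+ 2
    + (a * poch b 3 / poch (c - 3) 4) *: (fpsX ^+ 2 * fps_geom).
Proof.
rewrite -(hyp2F1_duality _ a b c hc) -(hyp2F1_lower3 _ a b c hc).
by rewrite !scalerAl -!mulrDl !mulrA.
Qed.

Theorem lemma5p1 (R : realType) (a b c : R[i])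
    (hc : forall m : int, c <> m%:~R) :
  hyp2F1 a b c * hyp2F1 (- a) (- b - 2) (- c)
  + (3 * a * b / (c * (c - 3))) *:
      (fpsX * hyp2F1 (a + 1) (b + 1) (c + 1) * hyp2F1 (- a) (- b - 2) (- c))
  + (3 * poch a 2 * poch b 2 / (poch c 2 * poch (c - 3) 2)) *:
      (fpsX ^+ 2 * hyp2F1 (a + 2) (b + 2) (c + 2)
         * hyp2F1 (- a) (- b - 2) (- c))
  + (poch a 3 * poch b 3 / poch (c - 3) 6) *:
      (fpsX ^+ 3 * hyp2F1 (a + 3) (b + 3) (c + 3)
         * hyp2F1 (- a) (- b - 2) (- c))
  + (a * poch b 3 * poch (a - c) 4 * poch (c - b - 3) 2
       / (poch (c - 4) 5 * poch (c - 3) 5)) *: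
      (fpsX ^+ 5 * hyp2F1 (a - c + 4) (b - c + 4) (5 - c)
         * hyp2F1 (- a + c + 1) (- b + c - 1) (c + 2))
  = 1
    + (a * (3 * b - 2 * c + 6) / (c * (c - 3))) *: fpsX
    + (a * (a - b - 1) * poch (c - b - 3) 2 / poch (c - 3) 4) *: fpsX ^+ 2
    + (a * poch b 3 / poch (c - 3) 4) *: (fpsX ^+ 2 * fps_geom).
Proof. exact: (hyp2F1_expanded_duality _ a b c hc). Qed.
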